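(* Let HT be the formal system defined in the context below, for an arbitrary fixed enumeration $(A_i)_{i\ge 1}$ of all formulas. Then the formula $T(\bot)$ (that is, the propositional variable $p_j$ for the unique index $j$ with $A_j=\bot$) is not a theorem of HT.
   Context: Language: a propositional language with countably many propositional variables $p_1,p_2,\ldots$ and a propositional constant $\bot$; formulas are built from the variables and $\bot$ using the binary connectives $\wedge$, $\vee$, $\to$. We write $\neg A$ for $A\to\bot$ and $A\leftrightarrow B$ for $(A\to B)\wedge(B\to A)$. Fix an enumeration $(A_i)_{i\ge1}$ of all formulas of this language in which every formula occurs exactly once (the $A_i$ are distinct). For a formula $A=A_i$, write $T(A)$ for the propositional variable $p_i$ (intended reading: ''$A$ is true''). The system HT consists of: (i) the axioms and deduction rule of the minimal propositional calculus (intuitionistic propositional calculus without ex falso quodlibet, $\bot$ being treated as an ordinary atom), e.g. all instances of $A\to(B\to A)$, $(A\to(B\to C))\to((A\to B)\to(A\to C))$, $A\wedge B\to A$, $A\wedge B\to B$, $A\to(B\to A\wedge B)$, $A\to A\vee B$, $B\to A\vee B$, $(A\to C)\to((B\to C)\to(A\vee B\to C))$, with modus ponens as the rule; (ii) for all formulas $A,B,C$ the axioms $A\to T(A)$; $T(A)\wedge T(B)\leftrightarrow T(A\wedge B)$; $T(A)\vee T(B)\to T(A\vee B)$; $T(A\vee B)\wedge T(A\to C)\wedge T(B\to C)\to T(C)$; $T(A)\wedge T(A\to B)\to T(B)$. A theorem of HT is a formula derivable from these axioms by modus ponens. *)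

(* Defs.v *)
From Stdlib Require Import Arith ConstructiveEpsilon.

(* Variables are numbered from 0: [Var i] is the variable p_(i+1). *)
Inductive formula : Type :=
  | Var (i : nat)
  | Bot
  | And (A B : formula)
  | Or (A B : formula)
  | Imp (A B : formula).

Declare Scope formula_scope.
Delimit Scope formula_scope with F.
Bind Scope formula_scope with formula.
Notation "A '∧' B" := (And A B) (at level 40, left associativity) : formula_scope.
Notation "A '∨' B" := (Or A B) (at level 50, left associativity) : formula_scope.
Notation "A '⇒' B" := (Imp A B) (at level 60, right associativity) : formula_scope.
Notation "A '⇔' B" := (And (Imp A B) (Imp B A)) (at level 65, no associativity) : formula_scope.

Definition formula_eq_dec (A B : formula) : {A = B} + {A <> B}.
Proof. decide equality; apply Nat.eq_dec. Defined.

(* Like the variables, the enumeration is numbered from 0: [enum_formula e i]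
   is A_(i+1). *)
Record enumeration : Type := Enumeration {
  enum_formula : nat -> formula;
  enum_once : forall A : formula, exists! i : nat, enum_formula i = A
}.

Definition index_sig (e : enumeration) (A : formula) :
    {i : nat | enum_formula e i = A} :=
  constructive_indefinite_ground_description_nat
    (fun i => enum_formula e i = A)
    (fun i => formula_eq_dec (enum_formula e i) A)
    (let (i, Hi) := enum_once e A in ex_intro _ i (proj1 Hi)).

Definition index (e : enumeration) (A : formula) : nat := proj1_sig (index_sig e A).

Lemma enum_index (e : enumeration) (A : formula) : enum_formula e (index e A) = A.
Proof. exact (proj2_sig (index_sig e A)). Qed.

Lemma index_enum (e : enumeration) (i : nat) : index e (enum_formula e i) = i.
Proof.
destruct (enum_once e (enum_formula e i)) as [j [_ uj]].
rewrite <- (uj _ (enum_index e _)).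
exact (uj i eq_refl).
Qed.

Definition T (e : enumeration) (A : formula) : formula := Var (index e A).

(* Minimal logic: there is no axiom for [Bot]. *)
Inductive HT (e : enumeration) : formula -> Prop :=
  | HT_K A B : HT e (A ⇒ B ⇒ A)
  | HT_S A B C : HT e ((A ⇒ B ⇒ C) ⇒ (A ⇒ B) ⇒ A ⇒ C)
  | HT_andl A B : HT e (A ∧ B ⇒ A)
  | HT_andr A B : HT e (A ∧ B ⇒ B)
  | HT_and A B : HT e (A ⇒ B ⇒ A ∧ B)
  | HT_orl A B : HT e (A ⇒ A ∨ B)
  | HT_orr A B : HT e (B ⇒ A ∨ B)
  | HT_or A B C : HT e ((A ⇒ C) ⇒ (B ⇒ C) ⇒ A ∨ B ⇒ C)
  | HT_T A : HT e (A ⇒ T e A)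
  | HT_T_and A B : HT e (T e A ∧ T e B ⇔ T e (A ∧ B))
  | HT_T_or A B : HT e (T e A ∨ T e B ⇒ T e (A ∨ B))
  | HT_T_case A B C : HT e (T e (A ∨ B) ∧ T e (A ⇒ C) ∧ T e (B ⇒ C) ⇒ T e C)
  | HT_T_mp A B : HT e (T e A ∧ T e (A ⇒ B) ⇒ T e B)
  | HT_mp A B : HT e A -> HT e (A ⇒ B) -> HT e B.

(* Main.v *)
(** A Kripke model with two worlds, the root below the top, refutes [T(⊥)].
    Reading "[T(A)] holds at a world" as "[A] holds at all strictly later worlds"
    is sound for the axioms and is not circular, even for self-referential
    enumerations: at the top every variable is true, and at the root [p_i] is
    true iff [A_i] is true at the top. Since [⊥] is false at the top, [T(⊥)]
    is false at the root. *)
Require Import Defs.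

Fixpoint top_forces (A : formula) : Prop :=
  match A with
  | Var _ => True
  | Bot => False
  | And A B => top_forces A /\ top_forces B
  | Or A B => top_forces A \/ top_forces B
  | Imp A B => top_forces A -> top_forces B
  end.

(** The second conjunct for [Imp] is the Kripke condition at the top world. *)
Fixpoint root_forces (e : enumeration) (A : formula) : Prop :=
  match A with
  | Var i => top_forces (enum_formula e i)
  | Bot => False
  | And A B => root_forces e A /\ root_forces e B
  | Or A B => root_forces e A \/ root_forces e B
  | Imp A B => (root_forces e A -> root_forces e B) /\ (top_forces A -> top_forces B)
  end.

(** Persistence: every variable holds at the top, and an implication carries its own top clause.
    This validates [A ⇒ T e A] at the root. *)
Lemma root_forces_top (e : enumeration) (A : formula) :
  root_forces e A -> top_forces A.
Proof. induction A; simpl; tauto. Qed.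

Lemma root_forces_T (e : enumeration) (A : formula) :
  root_forces e (T e A) <-> top_forces A.
Proof. simpl; rewrite enum_index; tauto. Qed.

Lemma HT_root_forces (e : enumeration) (A : formula) : HT e A -> root_forces e A.
Proof.
pose proof (root_forces_top e) as persist.
induction 1 as [A B|A B C|A B|A B|A B|A B|A B|A B C|A|A B|A B|A B C|A B|A B _ IHA _ IHAB];
  (* [T e A] becomes [True] at the top and [top_forces A] at the root, so each case is propositional
     given persistence; the [T] axioms reduce to ordinary inferences at the top. *)
  simpl in *; rewrite ?enum_index; simpl;
  try pose proof (persist A); try pose proof (persist B); try pose proof (persist C);
  tauto.
Qed.

Theorem theorem6p1 (e : enumeration) : ~ HT e (T e Bot).
Proof.
intros H; exact (proj1 (root_forces_T e Bot) (HT_root_forces e _ H)).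
Qed.
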